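(* Let $(m_n)_{n\in\mathbb N}$ be a sequence of positive integers such that $m_n\geq n$ for any $n\in\mathbb N$ and $\lim_{n\to\infty}\frac{m_n}{n}=1$. For each $n\in\mathbb N$ let $\Gamma_{n,m_n}$ be an $n$-regular graph on $m_n$ vertices. Then the disjoint union $\Gamma=\bigsqcup_{n\in\mathbb N}\Gamma_{n,m_n}$ is approximately uniformly locally finite (AULF).
   Context: All graphs are simple (no loops or multiple edges) and locally finite (every vertex has finitely many adjacent vertices), but not necessarily connected. $\mathbb N=\{1,2,3,\ldots\}$. A graph is $n$-regular if every vertex has degree $n$. For a graph $\Gamma$ with vertex set $V$, $d(v)$ is the degree of $v\in V$, $v\sim w$ means that $v$ and $w$ are adjacent, and $l^2(\Gamma)$ is the Hilbert space of square-summable complex functions on $V$, with orthonormal basis $\{\delta_v\}_{v\in V}$ of characteristic functions of vertices (the standard basis). The normalized Laplacian $L$ of $\Gamma$ is the bounded operator on $l^2(\Gamma)$ given by $Lf(v)=f(v)-\sum_{w\sim v}\frac{1}{\sqrt{d(v)d(w)}}f(w)$. For $d\in\mathbb N$, $\mathbb B^{(d)}$ is the set of bounded operators on $l^2(\Gamma)$ whose matrix with respect to the standard basis has at most $d$ non-zero entries in each row and in each column. Put $\mathbb B^{(\infty)}=\bigcup_{d\in\mathbb N}\mathbb B^{(d)}$ and let $\mathbb B$ be the closure of $\mathbb B^{(\infty)}$ in the operator norm. The graph $\Gamma$ is approximately uniformly locally finite (AULF) if $L\in\mathbb B$. *)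

(* Defs.v *)
From HB Require Import structures.
From mathcomp Require Import all_boot all_order all_algebra.
From mathcomp Require Import finmap.
From mathcomp Require Import all_classical all_reals all_analysis.
From mathcomp Require Import complex.
From mathcomp Require Import ring lra.

Set Implicit Arguments.
Unset Strict Implicit.
Unset Printing Implicit Defensive.
Import Order.TTheory GRing.Theory Num.Theory.
Import numFieldNormedType.Exports.
Import ComplexField.Normc.

Local Open Scope classical_set_scope.
Local Open Scope ring_scope.

Record graph (V : choiceType) := Graph {
  adj :> rel V;
  adj_sym : symmetric adj;
  adj_irr : irreflexive adj;
  adj_fin : forall v, finite_set [set w | adj v w] }.

Definition nbrs (V : choiceType) (G : graph V) (v : V) : set V :=
  [set w | G v w].

Definition degree (V : choiceType) (G : graph V) (v : V) : nat :=
  #|` fset_set (nbrs G v)|%fset.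

Definition regular (V : choiceType) (n : nat) (G : graph V) : Prop :=
  forall v, degree G v = n.

Section DisjointUnion.
Variables (I : choiceType) (V : I -> choiceType) (G : forall i, graph (V i)).

(* [tagged_as x y] is [tagged y] transported to the fibre of [x]; it is only
   meaningful under the guard [tag x == tag y]. *)
Definition dunion_adj : rel {i : I & V i} :=
  fun x y => (tag x == tag y) && G (tag x) (tagged x) (tagged_as x y).

Lemma dunion_sym : symmetric dunion_adj.
Proof.
move=> [i x] [j y]; rewrite /dunion_adj /= [j == i]eq_sym.
case: eqP => //= ij; case: j / ij y => y.
by rewrite !tagged_asE adj_sym.
Qed.

Lemma dunion_irr : irreflexive dunion_adj.
Proof. by move=> [i x]; rewrite /dunion_adj /= eqxx tagged_asE adj_irr. Qed.

Lemma dunion_fin v : finite_set [set w | dunion_adj v w].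
Proof.
case: v => i x.
apply: (@sub_finite_set _ _ (Tagged V @` [set w | G i x w])); last first.
  exact/finite_image/adj_fin.
move=> [j y]; rewrite /dunion_adj /=.
case: eqP => //= ij; case: j / ij y => y.
by rewrite tagged_asE => xy; exists y.
Qed.

Definition dunion : graph {i : I & V i} :=
  Graph dunion_sym dunion_irr dunion_fin.

End DisjointUnion.

Section SquareNorm.
Variable R : realType.
Implicit Types (x y : R[i]).

Lemma normc_sqr x : normc x ^+ 2 = complex.Re x ^+ 2 + complex.Im x ^+ 2.
Proof. by case: x => a b /=; rewrite sqr_sqrtr// addr_ge0// sqr_ge0. Qed.

Lemma normc_sqrD x y :
  normc (x + y) ^+ 2 <= 2 * normc x ^+ 2 + 2 * normc y ^+ 2.
Proof.
rewrite !normc_sqr; case: x y => [a b] [c d] /=.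
have := sqr_ge0 (a - c); have := sqr_ge0 (b - d); nra.
Qed.

Lemma normc_real (a : R) : 0 <= a -> normc a%:C%C = a.
Proof. by move=> a0; rewrite /= expr0n addr0 sqrtr_sqr ger0_norm. Qed.

Lemma normc_sqrM x y : normc (x * y) ^+ 2 = normc x ^+ 2 * normc y ^+ 2.
Proof. by rewrite normcM exprMn. Qed.

Lemma sqr_sum_le (T : Type) (s : seq T) (F : T -> R) :
  (\sum_(i <- s) F i) ^+ 2 <= (size s)%:R * \sum_(i <- s) F i ^+ 2.
Proof.
elim: s => [|a s IH]; first by rewrite !big_nil expr0n mul0r.
rewrite !big_cons /= -natr1.
have Q0 : 0 <= \sum_(i <- s) F i ^+ 2 by apply: sumr_ge0 => i _; exact: sqr_ge0.
move: IH Q0; set S := \sum_(i <- s) F i; set Q := \sum_(i <- s) _.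
have n0 : 0 <= (size s)%:R :> R by [].
move: n0; move: ((size s)%:R : R) (F a) => n x n0 IH Q0.
suff : 2 * x * S <= n * x ^+ 2 + Q by lra.
have [n1|n_gt0] := leP n 0.
  have -> : n = 0 by apply/le_anti; rewrite n1.
  have nE : n = 0 by apply/le_anti; rewrite n1.
  move: IH; rewrite nE mul0r => S0.
  have /eqP : S ^+ 2 == 0 by rewrite eq_le S0 sqr_ge0.
  by move/eqP; rewrite sqrf_eq0 => /eqP ->; rewrite mulr0 mul0r add0r.
rewrite -(ler_pM2l n_gt0).
have := sqr_ge0 (n * x - S); nra.
Qed.

Lemma normc_sqr_sum_le (T : Type) (s : seq T) (F : T -> R[i]) :
  normc (\sum_(i <- s) F i) ^+ 2
    <= (size s)%:R * \sum_(i <- s) normc (F i) ^+ 2.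
Proof.
have ReS : complex.Re (\sum_(i <- s) F i) = \sum_(i <- s) complex.Re (F i).
  by elim/big_rec2: _ => //= i y1 y2 _ <-; case: (F i) y2 => [? ?] [? ?].
have ImS : complex.Im (\sum_(i <- s) F i) = \sum_(i <- s) complex.Im (F i).
  by elim/big_rec2: _ => //= i y1 y2 _ <-; case: (F i) y2 => [? ?] [? ?].
rewrite normc_sqr ReS ImS.
under [X in _ <= _ * X]eq_bigr do rewrite normc_sqr.
by rewrite big_split /= mulrDr lerD// sqr_sum_le.
Qed.

Lemma esum_scale_le (T : choiceType) (c : R) (h : T -> R) :
  0 <= c -> (forall t, 0 <= h t) ->
  (\esum_(t in [set: T]) (c%:E * (h t)%:E)
     <= c%:E * \esum_(t in [set: T]) (h t)%:E)%E.
Proof.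
move=> c0 h0; apply: ge_ereal_sup => _ [X [finX XT] <-].
rewrite fsbig_finite//= -ge0_sume_distrr; last by move=> i _; rewrite lee_fin.
rewrite lee_wpmul2l//.
by apply: ereal_sup_ubound; exists X => //; rewrite fsbig_finite.
Qed.

End SquareNorm.

Section L2.
Variables (R : realType) (V : choiceType).

(* [R[i]^o] is [R[i]] seen as a module over itself, so that [V -> R[i]^o] is a
   complex vector space. *)
Definition square_summable : {pred V -> R[i]^o} :=
  fun f => summable [set: V] (fun v => (normc (f v) ^+ 2)%:E).

Lemma square_summableE (f : V -> R[i]^o) :
  (f \in square_summable) =
  (\esum_(v in [set: V]) (normc (f v) ^+ 2)%:E < +oo)%E.
Proof.
rewrite unfold_in /square_summable /summable; congr (_ < _)%E.
by apply: eq_esum => v _; rewrite gee0_abs// lee_fin sqr_ge0.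
Qed.

Lemma square_summable_submod : submod_closed square_summable.
Proof.
split.
  rewrite square_summableE esum1 ?ltry// => v _ /=.
  by rewrite expr0n addr0 sqrtr0 expr0n.
move=> a f g; rewrite !square_summableE => ff gg.
pose A := 2 * normc a ^+ 2.
apply: (@le_lt_trans _ _ (\esum_(v in [set: V])
   (A%:E * (normc (f v) ^+ 2)%:E + 2%:E * (normc (g v) ^+ 2)%:E))%E).
  apply: le_esum => v _; rewrite -!EFinM -EFinD lee_fin /A -mulrA -normc_sqrM.
  exact: normc_sqrD.
have A0 : 0 <= A by rewrite mulr_ge0// sqr_ge0.
have sc (c : R) (h : V -> R) : 0 <= c -> (forall v, 0 <= h v) ->
    (\esum_(v in [set: V]) (h v)%:E < +oo ->
     \esum_(v in [set: V]) (c%:E * (h v)%:E) < +oo)%E.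
  move=> c0 h0 hfin; apply: le_lt_trans (esum_scale_le c0 h0) _.
  by rewrite lte_mul_pinfty.
rewrite esumD.
- by rewrite lte_add_pinfty// sc// => v; rewrite sqr_ge0.
- by move=> v _; rewrite mule_ge0// lee_fin ?sqr_ge0.
- by move=> v _; rewrite mule_ge0// lee_fin ?sqr_ge0.
Qed.

HB.instance Definition _ :=
  GRing.isSubmodClosed.Build R[i] (V -> R[i]^o) square_summable
    square_summable_submod.

Record l2 := L2 {
  l2fun :> V -> R[i]^o;
  l2P : l2fun \in square_summable }.

HB.instance Definition _ := [isSub for l2fun].
HB.instance Definition _ := [Choice of l2 by <:].
HB.instance Definition _ := [SubChoice_isSubLmodule of l2 by <:].

Lemma l2_finite (f : l2) :
  (\esum_(v in [set: V]) (normc (f v) ^+ 2)%:E < +oo)%E.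
Proof. by rewrite -square_summableE l2P. Qed.

Definition l2norm (f : l2) : R :=
  Num.sqrt (fine (\esum_(v in [set: V]) (normc (f v) ^+ 2)%:E)%E).

Lemma delta_square_summable (w : V) :
  (fun v => (v == w)%:R : R[i]^o) \in square_summable.
Proof.
rewrite square_summableE.
rewrite (_ : \esum_(v in _) _ = 1%E) ?ltry//.
rewrite (esumID [set w])//; last by move=> v _; rewrite lee_fin sqr_ge0.
rewrite setTI setIC setIT esum_set1 ?lee_fin ?sqr_ge0// eqxx.
rewrite esum1; last first.
  move=> v /= vw; have /negbTE -> : v != w by apply/eqP.
  by rewrite /= !expr0n addr0 sqrtr0 expr0n.
by rewrite adde0 normc_sqr /= expr1n expr0n addr0.
Qed.

Definition delta (w : V) : l2 := L2 (delta_square_summable w).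

End L2.

Section NormalizedLaplacian.
Variables (R : realType) (V : choiceType) (G : graph V).

(* The neighbourhoods are finite, so the [fsbigop] sum is never the default 0;
   the square root is nonzero whenever [w] is a neighbour of [v]. *)
Definition laplacian_fun (f : V -> R[i]^o) : V -> R[i]^o := fun v =>
  f v - \sum_(w \in nbrs G v)
          ((Num.sqrt ((degree G v)%:R * (degree G w)%:R))^-1)%:C%C * f w.

Lemma nbrs_fin v : finite_set (nbrs G v). Proof. exact: adj_fin. Qed.

Lemma degree_gt0 v w : G v w -> (0 < degree G w)%N.
Proof.
move=> vw; rewrite /degree cardfs_gt0; apply/fset0Pn; exists v.
by rewrite in_fset_set ?inE; [rewrite /nbrs /= adj_sym|exact: nbrs_fin].
Qed.

Lemma laplacian_fun_linear : linear laplacian_fun.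
Proof.
move=> a f g; apply/funext => v; rewrite /laplacian_fun.
rewrite !fctE /= scalerBr addrACA -opprD; congr (_ - _).
rewrite (fsbig_finite _ _ (nbrs_fin v)) /=.
rewrite (fsbig_finite _ _ (nbrs_fin v)) /=.
rewrite (fsbig_finite _ _ (nbrs_fin v)) /=.
rewrite scaler_sumr -big_split /=; apply: eq_bigr => w _.
by rewrite mulrDr; congr (_ + _); exact: mulrCA.
Qed.

Lemma sum_nbrs_finite (f : l2 R V) :
  (\esum_(v in [set: V]) \esum_(w in nbrs G v)
     ((degree G w)%:R^-1 * normc (f w) ^+ 2)%:E < +oo)%E.
Proof.
have ge0 w : (0 <= ((degree G w)%:R^-1 * normc (f w) ^+ 2)%:E :> \bar R)%E.
  by rewrite lee_fin mulr_ge0// ?sqr_ge0// invr_ge0.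
rewrite esum_esum//.
rewrite (@reindex_esum _ _ _ ([set: V] `*`` nbrs G) _
  (fun k : V * V => (k.2, k.1))); last first.
  split.
  - by move=> [v w] [_ /= vw]; split => //; rewrite /nbrs /= adj_sym.
  - by move=> [v w] [v' w'] _ _ [-> ->].
  - move=> [v w] [_ /= vw]; exists (w, v) => //.
    by split => //; rewrite /nbrs /= adj_sym.
rewrite -(@esum_esum _ _ _ [set: V] (nbrs G)
  (fun w v => ((degree G w)%:R^-1 * normc (f w) ^+ 2)%:E))//.
apply: le_lt_trans (l2_finite f); apply: le_esum => w _.
rewrite esum_fset; [|exact: nbrs_fin|by []].
rewrite fsbig_finite; last exact: nbrs_fin.
rewrite sumEFin lee_fin big_const_seq count_predT iter_addr addr0.
rewrite -/(degree G w) -[leLHS]mulr_natl mulrA.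
have [->|d0] := eqVneq (degree G w) 0%N; first by rewrite !mul0r sqr_ge0.
by rewrite divff ?mul1r// pnatr_eq0.
Qed.

Lemma laplacian_square_summable (f : l2 R V) :
  laplacian_fun f \in @square_summable R V.
Proof.
suff : (fun v => \sum_(w \in nbrs G v)
    ((Num.sqrt ((degree G v)%:R * (degree G w)%:R))^-1)%:C%C * f w)
    \in @square_summable R V.
  by move=> h; apply: rpredB => //; exact: l2P.
rewrite square_summableE; apply: le_lt_trans (sum_nbrs_finite f).
apply: le_esum => v _.
rewrite esum_fset; [|exact: nbrs_fin|]; last first.
  by move=> w _; rewrite lee_fin mulr_ge0// ?sqr_ge0// invr_ge0.
rewrite !fsbig_finite; try exact: nbrs_fin.
rewrite sumEFin lee_fin; apply: le_trans (normc_sqr_sum_le _ _) _.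
rewrite -/(degree G v) mulr_sumr big_seq [leRHS]big_seq.
apply: ler_sum => w; rewrite in_fset_set; last exact: nbrs_fin.
rewrite inE => vw.
have dv : (degree G v)%:R != 0 :> R.
  by rewrite pnatr_eq0 -lt0n (@degree_gt0 w)// adj_sym.
rewrite normc_sqrM normc_real ?invr_ge0 ?sqrtr_ge0//.
rewrite exprVn sqr_sqrtr ?mulr_ge0// invfM !mulrA divff// mul1r.
by [].
Qed.

Definition laplacian (f : l2 R V) : l2 R V := L2 (laplacian_square_summable f).

Lemma laplacian_linear : linear laplacian.
Proof.
by move=> a f g; apply: val_inj; exact: laplacian_fun_linear.
Qed.

HB.instance Definition _ :=
  GRing.isLinear.Build R[i] (l2 R V) (l2 R V) _ laplacian laplacian_linear.

End NormalizedLaplacian.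

Section Operators.
Variables (R : realType) (V : choiceType).

(* The supremum is taken in [\bar R], so it is [+oo] for unbounded [T]. *)
Definition opnorm (T : l2 R V -> l2 R V) : \bar R :=
  ereal_sup [set (l2norm (T f))%:E | f in [set f | l2norm f <= 1]].

Definition bounded_op (T : {linear l2 R V -> l2 R V}) : Prop :=
  (opnorm T < +oo)%E.

(* Row [v], column [w]: the inner product of [T (delta w)] with [delta v]. *)
Definition matrix_entry (T : l2 R V -> l2 R V) (v w : V) : R[i] :=
  T (delta R w) v.

Definition sparse_op (d : nat) (T : {linear l2 R V -> l2 R V}) : Prop :=
  [/\ bounded_op T,
      forall v, ([set w | matrix_entry T v w != 0%R] #<= `I_d)%card &
      forall w, ([set v | matrix_entry T v w != 0%R] #<= `I_d)%card].

(* The union over [d >= 1] of the operators with [d]-sparse matrices. *)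
Definition finitely_sparse_op (T : {linear l2 R V -> l2 R V}) : Prop :=
  exists2 d : nat, (0 < d)%N & sparse_op d T.

(* The operator-norm closure of the [finitely_sparse_op] inside the bounded
   operators. *)
Definition approx_sparse_op (T : {linear l2 R V -> l2 R V}) : Prop :=
  bounded_op T /\
  forall e : R, 0 < e ->
    exists2 S : {linear l2 R V -> l2 R V},
      finitely_sparse_op S & (opnorm (T \- S)%R < e%:E)%E.

(* Approximately uniformly locally finite. *)
Definition AULF (G : graph V) : Prop := approx_sparse_op (laplacian G).

End Operators.

(* Main.v *)
Require Import Defs.
From HB Require Import structures.
From mathcomp Require Import all_boot all_order all_algebra.
From mathcomp Require Import finmap.
From mathcomp Require Import all_classical all_reals all_analysis.
From mathcomp Require Import complex.
From mathcomp Require Import ring lra.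

(** The Laplacian is block diagonal, with blocks 1 - A_n / n, where A_n is the
    adjacency matrix of an n-regular graph on m_n vertices.  Such a graph
    misses few edges of the complete graph: the row sums of the absolute values
    of A_n / n - J / m_n, where J is the all-ones matrix, are 2 (1 - n / m_n),
    which tends to 0, so by the Schur test ([schur],
    [adj_sub_mean_bounded]) A_n / n is close in norm to J / m_n, the orthogonal
    projection onto the constants.  The finitely many small blocks are sparse
    as they are, so everything reduces to approximating that projection on a
    set of arbitrary size by matrices with a number of entries per row and
    column that depends on the precision only ([sparse_mean]).

    This is the existence of expanders.  A family of permutations of a finite
    set is called [mixing] with rate e when the average of its permutation
    matrices is at distance at most e from the projection onto constants.

    - The seed ([mixing_cube]) comes from lines in a plane over a large prime
      field F.  The projections onto the functions invariant along two
      different directions have product J / m, so averaging over the directions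
      is close to J / m; and the averages along the lines may themselves be
      replaced by mixing families ([on_lines_mixing]).  Doing this twice,
      starting from the translations of F^6, gives p^8 permutations of a set
      with p^24 elements, that is, permutations of S * S * S labelled by S.

    - Let X carry a mixing family labelled by C = S * S * S.  On X * C one may
      move inside the C-coordinate with the seed, or use the C-coordinate as the
      label of a move in X.  Alternating the two (a replacement product in the
      spirit of the zig-zag product) gives a family on X * C labelled by
      S * S * S = C again, with rate a ^ 2 + 3 b if X has rate a and the seed has
      rate b ([replacement_mixing]).  With b = 1/12 the rate 1/2 reproduces
      itself, and the sizes |C| ^ i are all reached ([expander_tower]).

    - Composing the family with itself brings the rate below any precision
      ([mixing_words]).  A set V of arbitrary size embeds in one of size
      |C| ^ i <= |C| |V|, and the rescaled principal submatrix on V still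
      approximates the mean over V, the error growing by a factor of at most |C|
      ([compression_approx]).

    All the bounds concern real matrices and sums of squares, and they pass to
    complex l2 through real and imaginary parts ([block_fun_esum_le]). *)

Import Order.TTheory GRing.Theory Num.Theory.
Import numFieldNormedType.Exports.
Local Open Scope classical_set_scope.
Local Open Scope ring_scope.

Set Implicit Arguments.
Unset Strict Implicit.
Unset Printing Implicit Defensive.

(** * Means and square sums over finite types *)

Section FiniteMeans.
Variable R : realType.

Definition mean (X : finType) (f : X -> R) : R := #|X|%:R^-1 * \sum_x f x.

Definition sqnorm (X : finType) (f : X -> R) : R := \sum_x f x ^+ 2.

Implicit Types (X Y L : finType).

Lemma eq_mean X (f g : X -> R) : f =1 g -> mean f = mean g.
Proof. by move=> fg; rewrite /mean (eq_bigr g). Qed.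

Lemma eq_sqnorm X (f g : X -> R) : f =1 g -> sqnorm f = sqnorm g.
Proof. by move=> fg; apply: eq_bigr => x _; rewrite fg. Qed.

Lemma sqnorm_ge0 X (f : X -> R) : 0 <= sqnorm f.
Proof. by apply: sumr_ge0 => x _; exact: sqr_ge0. Qed.

Lemma mean_sum X (f : X -> R) : (0 < #|X|)%N -> \sum_x f x = #|X|%:R * mean f.
Proof. by move=> X0; rewrite /mean mulVKf// pnatr_eq0 -lt0n. Qed.

Lemma mean_cst X (c : R) : (0 < #|X|)%N -> mean (fun _ : X => c) = c.
Proof.
move=> X0; rewrite /mean big_const iter_addr addr0 -[c *+ _]mulr_natl mulKf//.
by rewrite pnatr_eq0 -lt0n.
Qed.

Lemma meanD X (f g : X -> R) : mean (fun x => f x + g x) = mean f + mean g.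
Proof. by rewrite /mean big_split mulrDr. Qed.

Lemma meanB X (f g : X -> R) : mean (fun x => f x - g x) = mean f - mean g.
Proof. by rewrite /mean sumrB mulrBr. Qed.

Lemma mean_exchange X Y (f : X -> Y -> R) :
  mean (fun x => mean (f x)) = mean (fun y => mean (f^~ y)).
Proof.
rewrite /mean -!mulr_sumr mulrCA exchange_big /=.
by rewrite mulr_sumr.
Qed.

Lemma mean_pair X Y (f : X * Y -> R) :
  mean f = mean (fun x => mean (fun y => f (x, y))).
Proof.
rewrite /mean -mulr_sumr pair_bigA/= card_prod natrM invfM -mulrA.
by congr (_ * (_ * _)); apply: eq_bigr => -[].
Qed.

(** Jensen's inequality for the square. *)
Lemma sqr_mean_le X (f : X -> R) : mean f ^+ 2 <= mean (fun x => f x ^+ 2).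
Proof.
rewrite /mean exprMn; have [X0|X0] := posnP #|X|.
  by rewrite X0 invr0 expr0n !mul0r.
rewrite expr2 -mulrA ler_wpM2l ?invr_ge0//.
rewrite ler_pdivrMl ?ltr0n//.
have := sqr_sum_le (index_enum X) f.
by rewrite -{2}[index_enum X]enumT /= -cardT.
Qed.

Lemma mean_perm X (s : X -> X) (f : X -> R) :
  injective s -> mean (fun x => f (s x)) = mean f.
Proof. by move=> s_inj; rewrite /mean [in RHS](reindex_inj s_inj). Qed.

Lemma sqnorm_perm X (s : X -> X) (f : X -> R) :
  injective s -> sqnorm (fun x => f (s x)) = sqnorm f.
Proof. by move=> s_inj; rewrite /sqnorm [in RHS](reindex_inj s_inj). Qed.

Lemma sqnorm_pair X Y (f : X * Y -> R) :
  sqnorm f = \sum_x sqnorm (fun y => f (x, y)).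
Proof. by rewrite /sqnorm pair_bigA; apply: eq_bigr => -[]. Qed.

Lemma sqnorm_mean_le L X (F : L -> X -> R) (c : R) : 0 <= c ->
  (forall l, sqnorm (F l) <= c) ->
  sqnorm (fun x => mean (fun l => F l x)) <= c.
Proof.
move=> c0 Fc.
apply: (@le_trans _ _ (\sum_x mean (fun l => F l x ^+ 2))).
  by apply: ler_sum => x _; exact: sqr_mean_le.
rewrite -mulr_sumr exchange_big /=.
have [L0|L0] := posnP #|L|; first by rewrite L0 invr0 mul0r.
rewrite ler_pdivrMl ?ltr0n//.
apply: le_trans (ler_sum _ (fun l _ => Fc l)) _.
by rewrite sumr_const mulr_natl.
Qed.

Lemma sqnorm_cst_mean_le X (f : X -> R) : sqnorm (fun _ : X => mean f) <= sqnorm f.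
Proof.
have [X0|X0] := posnP #|X|.
  by rewrite /sqnorm !big_pred0 // => x; have := card0_eq X0 x.
rewrite /sqnorm sumr_const -mulr_natl.
apply: le_trans (ler_wpM2l (ler0n _ _) (sqr_mean_le f)) _.
by rewrite -mean_sum.
Qed.

(** Convexity of the square gives the triangle inequality without square roots
    (for positive bounds): (u + v)^2 <= (a + b)(u^2 / a + v^2 / b). *)
Lemma sqnormD X (f g : X -> R) (a b N : R) : 0 < a -> 0 < b ->
  sqnorm f <= a ^+ 2 * N -> sqnorm g <= b ^+ 2 * N ->
  sqnorm (fun x => f x + g x) <= (a + b) ^+ 2 * N.
Proof.
move=> a0 b0 fa gb.
apply: (@le_trans _ _ ((a + b) * (a^-1 * sqnorm f + b^-1 * sqnorm g))).
  rewrite /sqnorm !mulr_sumr -big_split /= mulr_sumr; apply: ler_sum => x _.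
  move: (f x) (g x) => u v; rewrite -subr_ge0.
  have -> : (a + b) * (a^-1 * u ^+ 2 + b^-1 * v ^+ 2) - (u + v) ^+ 2 =
            (b * u - a * v) ^+ 2 / (a * b).
    by field; rewrite !gt_eqF.
  by rewrite divr_ge0 ?sqr_ge0// mulr_ge0// ltW.
have ab0 : 0 <= a + b by rewrite addr_ge0// ltW.
rewrite expr2 -mulrA ler_wpM2l// mulrDl lerD// ler_pdivrMl//.
  by rewrite mulrA -expr2.
by rewrite mulrA -expr2.
Qed.

Lemma sqnorm_subr_mean X (f : X -> R) :
  sqnorm (fun x => f x - mean f) <= sqnorm f.
Proof.
have [X0|X0] := posnP #|X|.
  by rewrite /sqnorm !big_pred0 // => x; have := card0_eq X0 x.
rewrite /sqnorm -subr_ge0 -sumrB.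
rewrite (eq_bigr (fun x => 2 * mean f * f x - mean f ^+ 2)); last by move=> x _; ring.
rewrite sumrB -mulr_sumr mean_sum// sumr_const -[mean f ^+ 2 *+ _]mulr_natl.
set n := #|X|%:R.
have -> : 2 * mean f * (n * mean f) - n * mean f ^+ 2 = n * mean f ^+ 2 by ring.
by rewrite mulr_ge0 ?sqr_ge0.
Qed.

(** * Mixing families of permutations *)

Definition walk L X (s : L -> X -> X) (f : X -> R) (x : X) : R :=
  mean (fun l => f (s l x)).

(** The second clause bounds the norm distance between [walk s] and the
    projection onto constants; for the neighbour maps of a regular graph, [e]
    bounds the normalized second singular value. *)
Definition mixing (e : R) L X (s : L -> X -> X) : Prop :=
  (forall l, injective (s l)) /\
  forall f : X -> R, sqnorm (fun x => walk s f x - mean f) <= e ^+ 2 * sqnorm f.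

Lemma sqnorm_walk L X (s : L -> X -> X) (f : X -> R) :
  (forall l, injective (s l)) -> sqnorm (walk s f) <= sqnorm f.
Proof.
move=> s_inj; apply: sqnorm_mean_le; first exact: sqnorm_ge0.
by move=> l; rewrite sqnorm_perm.
Qed.

Lemma mean_walk L X (s : L -> X -> X) (f : X -> R) : (0 < #|L|)%N ->
  (forall l, injective (s l)) -> mean (walk s f) = mean f.
Proof.
move=> L0 s_inj; rewrite /walk mean_exchange -[RHS](@mean_cst L)//.
by apply: eq_mean => l; rewrite mean_perm.
Qed.

Lemma walkD_cst L X (s : L -> X -> X) (f : X -> R) (c : R) x : (0 < #|L|)%N ->
  walk s (fun y => f y + c) x = walk s f x + c.
Proof. by move=> L0; rewrite /walk meanD mean_cst. Qed.

Definition compose L L' X (s : L -> X -> X) (t : L' -> X -> X) :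
  L * L' -> X -> X := fun l x => t l.2 (s l.1 x).

(** After the first walk what remains of [f], minus its mean, has mean zero, so
    the second walk contracts it again. *)
Lemma mixing_compose (a b : R) L L' X (s : L -> X -> X) (t : L' -> X -> X) :
  (0 < #|L|)%N -> (0 < #|L'|)%N -> mixing a s -> mixing b t ->
  mixing (a * b) (compose s t).
Proof.
move=> L0 L'0 [s_inj sa] [t_inj tb]; split.
  by move=> [l l'] x y /= /t_inj /s_inj.
move=> f; pose g x := walk t f x - mean f.
rewrite (@eq_sqnorm _ _ (fun x => walk s g x - mean g)); last first.
  move=> x; have X0 : (0 < #|X|)%N by apply/card_gt0P; exists x.
  (* the constant [mean f] subtracted in [g] cancels *)
  rewrite /g walkD_cst// meanB mean_walk// mean_cst// subrr subr0; congr (_ - _).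
  by rewrite /walk mean_pair.
apply: le_trans (sa g) _.
by rewrite exprMn -[_ * b ^+ 2 * _]mulrA ler_wpM2l ?sqr_ge0// tb.
Qed.

Lemma card_le_inj X Y : (#|X| <= #|Y|)%N -> exists f : X -> Y, injective f.
Proof.
move=> XY; exists (fun x => enum_val (widen_ord XY (enum_rank x))).
by move=> x y /enum_val_inj/(congr1 val)/= /val_inj/enum_rank_inj.
Qed.

Lemma mixing_transport (e : R) L X Y (s : L -> X -> X) :
  #|X| = #|Y| -> mixing e s -> exists t : L -> Y -> Y, mixing e t.
Proof.
move=> XY [s_inj se].
have [h h_inj] : exists h : Y -> X, injective h by apply: card_le_inj; rewrite XY.
have [k hK kK] : bijective h by apply: inj_card_bij; rewrite ?XY.
exists (fun l y => k (s l (h y))); split.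
  by move=> l x y /(can_inj kK)/s_inj/h_inj.
have hb : {on [pred _ | true], bijective h} by exists k => x _.
move=> f; have := se (f \o k).
rewrite /sqnorm !(reindex _ hb)/=.
under [in X in _ -> _ <= X]eq_bigr do rewrite -[X in f X]hK.
have <- : mean (f \o k) = mean f.
  rewrite /mean XY (reindex _ hb)/=; congr (_ * _).
  by apply: eq_bigr => y _ /=; rewrite hK.
by [].
Qed.

End FiniteMeans.

(** * Families acting along the lines of a plane *)

Section Lines.
Variables (R : realType) (F : finFieldType) (U : finLmodType F) (L : finType).
Variable s : L -> U -> U.

(** A point stays on its line of slope [k.1]; the family [s] acts on abscissas. *)
Definition on_lines (k : F * L) (v : U * U) : U * U :=
  let a := s k.2 v.1 in (a, v.2 + k.1 *: (a - v.1)).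

(* [line x (a, t)] is the point of abscissa [a] on the line of slope [x] and
   intercept [t]. *)
Let line (x : F) (v : U * U) : U * U := (v.1, v.2 + x *: v.1).

Let line_inj x : injective (line x).
Proof. by move=> [a t] [b u] [/= -> /addIr ->]. Qed.

Let line_mean (x : F) (f : U * U -> R) (t : U) : R :=
  mean (fun a => f (line x (a, t))).

Let proj (x : F) (f : U * U -> R) (v : U * U) : R :=
  line_mean x f (v.2 - x *: v.1).

Let proj_line x f a t : proj x f (line x (a, t)) = line_mean x f t.
Proof. by rewrite /proj /= addrK. Qed.

Let sqnorm_line x (f : U * U -> R) :
  sqnorm f = \sum_t sqnorm (fun a => f (line x (a, t))).
Proof. by rewrite -(sqnorm_perm _ (@line_inj x)) sqnorm_pair exchange_big. Qed.

Let sqnorm_proj x f : sqnorm (proj x f) <= sqnorm f.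
Proof.
rewrite (sqnorm_line x) [leRHS](sqnorm_line x); apply: ler_sum => t _.
under eq_sqnorm do rewrite proj_line.
exact: sqnorm_cst_mean_le.
Qed.

Let sum_line_mean x (f : U * U -> R) : mean f = 0 -> \sum_t line_mean x f t = 0.
Proof.
move=> f0; have U0 : (0 < #|U|)%N by apply/card_gt0P; exists 0.
rewrite mean_sum// /line_mean mean_exchange.
by rewrite -(mean_pair (fun v => f (line x v))) (mean_perm _ (@line_inj x)) f0 mulr0.
Qed.

(* Lines of slopes [x] and [y] meet in exactly one point, so a point can be
   described by the intercepts of its two lines; the sum then factors into two
   sums over intercepts, each of which is the total of [f] up to a scalar. *)
Let proj_orthogonal x y (f : U * U -> R) : mean f = 0 -> x != y ->
  \sum_v proj x f v * proj y f v = 0.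
Proof.
move=> f0 xy; pose h (v : U * U) := (v.2 - x *: v.1, v.2 - y *: v.1).
have h_inj : injective h.
  move=> [a b] [c d] [/= e1 e2].
  have : (x - y) *: (a - c) = 0.
    apply/eqP; rewrite scalerBr !scalerBl subr_eq0; apply/eqP.
    have -> : x *: a - y *: a = (b - y *: a) - (b - x *: a).
      by rewrite opprB [RHS]addrC addrA subrK.
    by rewrite e1 e2 opprB [LHS]addrC addrA subrK.
  move/eqP; rewrite scaler_eq0 subr_eq0 (negPf xy) /= subr_eq0 => /eqP ac.
  by move: e1; rewrite ac => /addIr ->.
transitivity (\sum_v line_mean x f (h v).1 * line_mean y f (h v).2) => //.
rewrite -(reindex_inj h_inj (P := predT)
  (F := fun w => line_mean x f w.1 * line_mean y f w.2)).
rewrite -(pair_bigA _ (fun t u => line_mean x f t * line_mean y f u))/=.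
under eq_bigr do rewrite -mulr_sumr sum_line_mean// mulr0.
by rewrite big1.
Qed.

Let sqnorm_mean_proj (f : U * U -> R) : mean f = 0 ->
  sqnorm (fun v => mean (fun x => proj x f v)) <= #|F|%:R^-1 * sqnorm f.
Proof.
move=> f0; have F0 : (0 < #|F|)%N by apply/card_gt0P; exists 0.
have -> : sqnorm (fun v => mean (fun x => proj x f v)) =
    #|F|%:R^-1 ^+ 2 * \sum_x sqnorm (proj x f).
  rewrite /sqnorm /mean.
  under eq_bigr do rewrite exprMn.
  rewrite -mulr_sumr; congr (_ * _).
  under eq_bigr do rewrite expr2 big_distrlr.
  rewrite exchange_big; apply: eq_bigr => x _ /=.
  rewrite exchange_big (bigD1 x)//= [X in _ + X]big1 ?addr0// => y yx.
  by rewrite proj_orthogonal// eq_sym.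
rewrite expr2 -mulrA ler_wpM2l ?invr_ge0// ler_pdivrMl ?ltr0n//.
apply: le_trans (ler_sum _ (fun x _ => sqnorm_proj x f)) _.
by rewrite sumr_const mulr_natl.
Qed.

(** Averaging over slopes the projections onto functions constant along lines
    leaves, on functions of mean zero, an average of #|F| pairwise orthogonal
    contractions, of norm at most #|F| ^ (-1/2).  Replacing each of these
    projections by the walk along the lines costs [e]. *)
Lemma on_lines_mixing (e d : R) : 0 < e -> 0 < d -> #|F|%:R^-1 <= d ^+ 2 ->
  mixing e s -> mixing (e + d) on_lines.
Proof.
move=> e0 d0 Fd [s_inj se]; split.
  move=> [x l] [a b] [a' b'] [/= /s_inj <-].
  by move=> /addIr ->.
move=> f; have F0 : (0 < #|F|)%N by apply/card_gt0P; exists 0.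
have U0 : (0 < #|{: U * U}|)%N by apply/card_gt0P; exists (0, 0).
pose g v := f v - mean f.
pose B x v := mean (fun l => f (on_lines (x, l) v)).
have g0 : mean g = 0 by rewrite /g meanB mean_cst// subrr.
rewrite (@eq_sqnorm _ _ _ (fun v =>
  mean (fun x => B x v - proj x f v) + mean (fun x => proj x g v))); last first.
  move=> v; rewrite meanB /walk mean_pair -addrA; congr (_ + _).
  have -> : mean (fun x => proj x g v) = mean (fun x => proj x f v - mean f).
    apply: eq_mean => x; rewrite /proj /line_mean /g meanB mean_cst//.
    by apply/card_gt0P; exists 0.
  by rewrite meanB mean_cst// addrA addNr add0r.
apply: sqnormD => //.
  apply: sqnorm_mean_le => [|x]; first by rewrite mulr_ge0 ?sqr_ge0 ?sqnorm_ge0.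
  rewrite (sqnorm_line x) [in leRHS](sqnorm_line x) mulr_sumr.
  apply: ler_sum => t _; apply: le_trans (se _).
  rewrite le_eqVlt; apply/orP; left; apply/eqP/eq_sqnorm => a.
  rewrite proj_line; congr (_ - _); apply: eq_mean => l.
  congr (f _); rewrite /on_lines /line /=; congr (_, _).
  by rewrite scalerBr addrCA addrK addrC.
apply: le_trans (sqnorm_mean_proj g0) _.
by apply: ler_pM => //; rewrite ?invr_ge0 ?sqnorm_ge0// sqnorm_subr_mean.
Qed.

End Lines.

(** * A replacement product *)

Section ReplacementProduct.
Variables (R : realType) (X C S : finType).
Variables (s : C -> X -> X) (t : S -> C -> C).

Let hop (i : S) (v : X * C) : X * C := (v.1, t i v.2).
Let jump (v : X * C) : X * C := (s v.2 v.1, v.2).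

Definition replacement (k : S * S * S) (v : X * C) : X * C :=
  hop k.2 (jump (hop k.1.2 (jump (hop k.1.1 v)))).

Let B (f : X * C -> R) v := walk t (fun c => f (v.1, c)) v.2.
Let U (f : X * C -> R) v := f (jump v).
Let P (f : X * C -> R) (v : X * C) := mean (fun c => f (v.1, c)).

Let PB f g v : P (fun w => f w - g w) v = P f v - P g v.
Proof. exact: meanB. Qed.

Let sqnormP f : sqnorm (P f) <= sqnorm f.
Proof.
rewrite !sqnorm_pair; apply: ler_sum => x _.
exact: (sqnorm_cst_mean_le (fun c => f (x, c))).
Qed.

Let walk_replacement f v : walk replacement f v = B (U (B (U (B f)))) v.
Proof. by rewrite /walk mean_pair mean_pair. Qed.

(** Write B for the walk [t] on the C-coordinate, P for the average over that
    coordinate, and U for the permutation that uses it as a label.  The walk is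
    B U B U B; replacing the B's by P one at a time costs [b] each, and
    P U P U P is two steps of the walk [s] on X, of rate [a ^ 2]. *)
Lemma replacement_mixing (a b : R) : (0 < #|C|)%N -> 0 < a -> 0 < b ->
  mixing a s -> mixing b t -> mixing (a ^+ 2 + 3 * b) replacement.
Proof.
move=> C0 a0 b0 sa [t_inj tb].
have jump_inj : injective jump.
  move=> [x c] [y d] [/= + e]; rewrite -e.
  by have [s_inj _] := sa; move=> /s_inj ->.
have hop_inj i : injective (hop i) by move=> [x c] [y d] [/= -> /t_inj ->].
split; first by move=> k v w /hop_inj /jump_inj /hop_inj /jump_inj /hop_inj.
have sqnormU f : sqnorm (U f) = sqnorm f by exact: sqnorm_perm.
have sqnormB f : sqnorm (B f) <= sqnorm f.
  rewrite !sqnorm_pair; apply: ler_sum => x _.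
  exact: (sqnorm_walk (fun c => f (x, c)) t_inj).
have BP f : sqnorm (fun v => B f v - P f v) <= b ^+ 2 * sqnorm f.
  rewrite !sqnorm_pair mulr_sumr; apply: ler_sum => x _; exact: (tb (fun c => f (x, c))).
move=> f; pose h x := mean (fun c => f (x, c)).
pose g := U (B f); pose g' := U (B (U (B f))).
have PUPUP v : P (U (P (U (P f)))) v = walk (compose s s) h v.1.
  by rewrite /walk mean_pair.
rewrite (@eq_sqnorm _ _ _ (fun v =>
  (walk (compose s s) h v.1 - mean h) +
    (P (U (P (U (fun w => B f w - P f w)))) v +
      (P (U (fun w => B g w - P g w)) v +
       (B g' v - P g' v))))); last first.
  move=> v; rewrite walk_replacement -PUPUP mean_pair -/h.
  have -> : P (U (P (U (fun w => B f w - P f w)))) v =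
            P (U (P g)) v - P (U (P (U (P f)))) v.
    by rewrite -PB; congr mean; apply/funext => c; rewrite {1}/U PB.
  have -> : P (U (fun w => B g w - P g w)) v = P g' v - P (U (P g)) v.
    by rewrite -PB.
  by rewrite /g' /g; ring.
have N0 := sqnorm_ge0 f.
have -> : a ^+ 2 + 3 * b = a * a + (b + (b + b)) by ring.
apply: sqnormD; rewrite ?mulr_gt0 ?addr_gt0//.
  have [_ /(_ h)] := mixing_compose C0 C0 sa sa.
  rewrite -(@ler_pM2l _ #|C|%:R) ?ltr0n// => /le_trans le_h.
  have -> : sqnorm (fun v : X * C => walk (compose s s) h v.1 - mean h) =
      #|C|%:R * sqnorm (fun x => walk (compose s s) h x - mean h).
    rewrite sqnorm_pair /sqnorm mulr_sumr; apply: eq_bigr => x _ /=.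
    by rewrite sumr_const mulr_natl.
  apply: le_h; rewrite mulrCA ler_wpM2l ?sqr_ge0//.
  apply: le_trans (sqnormP f).
  rewrite [leRHS]sqnorm_pair /sqnorm mulr_sumr; apply: ler_sum => x _ /=.
  by rewrite /P /= sumr_const mulr_natl.
have bN : 0 <= b ^+ 2 by exact: sqr_ge0.
apply: sqnormD; rewrite ?addr_gt0//.
  by rewrite (le_trans (sqnormP _))// sqnormU (le_trans (sqnormP _))// sqnormU.
apply: sqnormD => //.
  rewrite (le_trans (sqnormP _))// sqnormU (le_trans (BP _))//.
  by rewrite ler_wpM2l// /g sqnormU.
rewrite (le_trans (BP _))// ler_wpM2l// /g' sqnormU.
by rewrite (le_trans (sqnormB _))// sqnormU.
Qed.

End ReplacementProduct.

(** * Expanders with a bounded number of labels *)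

Section Expanders.
Variable R : realType.
Implicit Types C L V X : finType.

Lemma mixing_translations (U : finZmodType) (e : R) : mixing e (fun u v : U => u + v).
Proof.
split=> [u v w /addrI //|f]; rewrite [sqnorm _]big1; last first.
  move=> v _; rewrite /walk; under eq_mean do rewrite addrC.
  by rewrite (mean_perm _ (@addrI _ v)) subrr expr0n.
by rewrite mulr_ge0 ?sqr_ge0 ?sqnorm_ge0.
Qed.

(** Using lines twice, F * (F * F^r) labels a family on F^(2r) * F^(2r): p^(r+2)
    permutations of p^(4r) points.  The exponent r = 6 makes the latter the cube
    of the former.  An error 1/36 is spent on the translations and on each of
    the two uses of lines. *)
Lemma mixing_cube : exists2 S : finType, (1 < #|S|)%N &
  exists t : S -> S * S * S -> S * S * S, mixing (12^-1 : R) t.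
Proof.
have [p p_big p_prime] := prime_above (36 * 36).
pose F : finFieldType := 'F_p; have cF : #|F| = p by exact: card_Fp.
have Fd : #|F|%:R^-1 <= (36^-1 : R) ^+ 2.
  rewrite cF exprVn lef_pV2 ?posrE ?exprn_gt0//.
    by rewrite expr2 -natrM ler_nat ltnW.
  by rewrite ltr0n prime_gt0.
have e0 : 0 < 36^-1 :> R by rewrite invr_gt0.
pose U : finLmodType F := 'rV[F]_6; pose V : finLmodType F := 'rV[F]_12.
have cUV : #|{: U * U}| = #|V| by rewrite card_prod !card_mx -expnD.
have [s sm] := mixing_transport cUV
  (on_lines_mixing e0 e0 Fd (mixing_translations U _)).
have e1 : 0 < 36^-1 + 36^-1 :> R by rewrite addr_gt0.
have := on_lines_mixing e1 e0 Fd sm.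
pose S : finType := (F * (F * U))%type.
have cS : #|S| = (p ^ 8)%N by rewrite !card_prod card_mx cF -!expnS.
have -> : 36^-1 + 36^-1 + 36^-1 = 12^-1 :> R by field.
have cVS : #|{: V * V}| = #|{: S * S * S}|.
  by rewrite !card_prod !card_mx cF -!expnS -!expnD.
move=> /(mixing_transport cVS)[t tm]; exists S; last by exists t.
by rewrite cS -[X in (X < _)%N](expn0 p) ltn_exp2l// prime_gt1.
Qed.

(** [1/2] is a fixed point of the recursion [a |-> a ^ 2 + 3 * b] of the
    replacement product when [b = 1/12]. *)
Lemma expander_tower : exists2 C : finType, (1 < #|C|)%N &
  forall i : nat, exists2 X : finType, #|X| = (#|C| ^ i)%N &
    exists s : C -> X -> X, mixing (2^-1 : R) s.
Proof.
have [S S1 [t tm]] := mixing_cube; pose C : finType := (S * S * S)%type.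
have cC : (1 < #|C|)%N.
  rewrite !card_prod (leq_trans S1)// -mulnA leq_pmulr// muln_gt0.
  by rewrite (ltn_trans _ S1).
exists C => //; elim=> [|i [X cX [s sm]]].
  exists unit; first by rewrite card_unit.
  exists (fun _ => id); split=> [_ x y //|f]; rewrite [sqnorm _]big1 => [|x _].
    by rewrite mulr_ge0 ?sqr_ge0 ?sqnorm_ge0.
  rewrite /walk mean_cst ?(ltn_trans _ cC)//.
  rewrite (eq_mean (g := fun=> f x)) ?mean_cst ?card_unit ?subrr ?expr0n//.
  by move=> y; case: x y => -[].
exists (X * C)%type; first by rewrite card_prod cX expnSr.
exists (replacement s t).
have -> : 2^-1 = 2^-1 ^+ 2 + 3 * 12^-1 :> R by field.
by apply: replacement_mixing => //; rewrite (ltn_trans _ cC).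
Qed.

(** Labels of the (n+1)-fold composition; they depend on [C] and [n] only, not
    on the set acted upon. *)
Fixpoint words (C : finType) (n : nat) : finType :=
  if n is n'.+1 then (words C n' * C)%type else C.

Lemma card_words_gt0 C n : (0 < #|C|)%N -> (0 < #|words C n|)%N.
Proof. by move=> C0; elim: n => //= n IH; rewrite card_prod muln_gt0 IH. Qed.

Lemma mixing_words (a : R) C X (s : C -> X -> X) n : (0 < #|C|)%N ->
  mixing a s -> exists t : words C n -> X -> X, mixing (a ^+ n.+1) t.
Proof.
move=> C0 sm; elim: n => [|n [t tm]]; first by exists s.
exists (compose t s); rewrite exprSr.
by apply: mixing_compose => //; exact: card_words_gt0.
Qed.

Lemma expanders : exists2 q : nat, (1 < q)%N &
  forall e : R, 0 < e -> exists2 L : finType, (0 < #|L|)%N &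
  forall i : nat, exists2 X : finType, #|X| = (q ^ i)%N &
    exists s : L -> X -> X, mixing e s.
Proof.
have [C C1 tower] := expander_tower; exists #|C| => // e e0.
have C0 : (0 < #|C|)%N by exact: ltnW.
have [n ne] : exists n, 2^-1 ^+ n.+1 <= e.
  exists (Num.bound e^-1); rewrite exprVn invf_ple ?posrE ?exprn_gt0//.
  by rewrite ltW// upper_nthrootP.
exists (words C n); first exact: card_words_gt0.
move=> i; have [X cX [s sm]] := tower i.
exists X => //; have [t [t_inj tm]] := mixing_words n C0 sm.
exists t; split=> // f; apply: le_trans (tm f) _.
by rewrite ler_wpM2r ?sqnorm_ge0// lerXn2r// ?nnegrE ?(ltW e0)//.
Qed.

Lemma card_le_labels L V (A : {set V}) (r : L -> V -> bool) : (0 < #|L|)%N ->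
  (forall v, v \in A -> exists l, r l v) ->
  (forall l v w, r l v -> r l w -> v = w) -> (#|A| <= #|L|)%N.
Proof.
move=> /card_gt0P[l0 _] Ar r_inj.
pose f v := odflt l0 [pick l | r l v].
have fP v : v \in A -> r (f v) v.
  by rewrite /f => /Ar[l rl]; case: pickP => // /(_ l); rewrite rl.
rewrite -(card_in_imset (f := f)) ?max_card// => v w /fP rv /fP rw vw.
by apply: (r_inj (f v)) => //; rewrite vw.
Qed.

(** * Sparse approximation of the mean on an arbitrary finite set *)

Section Compression.
Variables (V X : finType) (i : V -> X).
Hypothesis i_inj : injective i.

(* Extension by zero along the injection [i]. *)
Let extend (f : V -> R) (x : X) : R := \sum_w (x == i w)%:R * f w.

Let extendE f w : extend f (i w) = f w.
Proof.
rewrite /extend (bigD1 w)//= eqxx mul1r big1 ?addr0// => u uw.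
by rewrite (inj_eq i_inj) eq_sym (negPf uw) mul0r.
Qed.

Let extend0 f x : x \notin i @: predT -> extend f x = 0.
Proof.
move=> xi; apply: big1 => w _; case: eqP => [xE|_]; last by rewrite mul0r.
by rewrite xE imset_f in xi.
Qed.

Let sum_image (h : X -> R) : \sum_(x in i @: predT) h x = \sum_v h (i v).
Proof. by rewrite big_imset; [exact: eq_bigl|exact: in2W]. Qed.

(** The principal submatrix on the image of [i] of the average of the
    permutation matrices.  The factor turns the mean over [X] of a function
    supported in that image into its mean over [V]. *)
Definition compression L (s : L -> X -> X) (v w : V) : R :=
  #|X|%:R / #|V|%:R * mean (fun l => (s l (i v) == i w)%:R).

(** This is the mixing bound on [X], applied to the extension of [f] by zero and
    restricted to the image of [i]. *)
Lemma compression_approx L (s : L -> X -> X) (e : R) : (0 < #|X|)%N ->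
  mixing e s -> forall f : V -> R,
  sqnorm (fun v => \sum_w compression s v w * f w - mean f) <=
  (#|X|%:R / #|V|%:R * e) ^+ 2 * sqnorm f.
Proof.
move=> X0 [_ sm] f; set c := _ / _.
have sum_extend : \sum_x extend f x = \sum_v f v.
  rewrite (bigID (mem (i @: predT)))/= sum_image [X in _ + X]big1 ?addr0.
    by apply: eq_bigr => v _; rewrite extendE.
  by move=> x; exact: extend0.
have sqnorm_extend : sqnorm (extend f) = sqnorm f.
  rewrite /sqnorm (bigID (mem (i @: predT)))/=.
  rewrite (sum_image (fun x => extend f x ^+ 2)) [X in _ + X]big1 ?addr0.
    by apply: eq_bigr => v _; rewrite extendE.
  by move=> x /extend0 ->; rewrite expr0n.
rewrite (@eq_sqnorm _ _ _ (fun v =>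
  c * (walk s (extend f) (i v) - mean (extend f)))); last first.
  move=> v; rewrite mulrBr; congr (_ - _).
    rewrite /walk /extend /compression -/c /mean.
    rewrite exchange_big !mulr_sumr; apply: eq_bigr => w _.
    by rewrite -mulr_suml !mulrA.
  rewrite /mean sum_extend /c mulrA; congr (_ * _).
  by rewrite mulrAC divff ?mul1r// pnatr_eq0 -lt0n.
rewrite exprMn -[leRHS]mulrA -sqnorm_extend.
apply: le_trans (ler_wpM2l (sqr_ge0 _) (sm _)).
rewrite /sqnorm mulr_sumr.
rewrite [leRHS](bigID (mem (i @: predT)))/= sum_image -[leLHS]addr0.
apply: lerD; last by apply: sumr_ge0 => x _; rewrite mulr_ge0 ?sqr_ge0.
by apply: ler_sum => v _; rewrite exprMn.
Qed.

Lemma compression_sparse_row L (s : L -> X -> X) v : (0 < #|L|)%N ->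
  (#|[set w | compression s v w != 0%R]%SET| <= #|L|)%N.
Proof.
move=> L0; apply: (card_le_labels (r := fun l w => s l (i v) == i w)) => // [w|].
  rewrite inE; apply: contraNP => /forallNP nl.
  rewrite /compression /mean big1 ?mulr0// => l _.
  by case: eqP => // /eqP sl; case: (nl l).
by move=> l w u /eqP -> /eqP /i_inj.
Qed.

Lemma compression_sparse_col L (s : L -> X -> X) w : (0 < #|L|)%N ->
  (forall l, injective (s l)) ->
  (#|[set v | compression s v w != 0%R]%SET| <= #|L|)%N.
Proof.
move=> L0 s_inj.
apply: (card_le_labels (r := fun l v => s l (i v) == i w)) => // [v|].
  rewrite inE; apply: contraNP => /forallNP nl.
  rewrite /compression /mean big1 ?mulr0// => l _.
  by case: eqP => // /eqP sl; case: (nl l).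
by move=> l v u /eqP <- /eqP /s_inj /i_inj.
Qed.

End Compression.

(** The tower has a member of size between [#|V|] and [q * #|V|]; its rate is
    taken [q] times smaller than [e] to pay for the compression.  That [q] does
    not depend on the rate is what makes this possible. *)
Lemma sparse_mean (e : R) : 0 < e -> exists d : nat,
  forall V : finType, (0 < #|V|)%N -> exists k : V -> V -> R,
  [/\ forall v, (#|[set w | k v w != 0%R]%SET| <= d)%N,
      forall w, (#|[set v | k v w != 0%R]%SET| <= d)%N &
      forall f : V -> R,
        sqnorm (fun v => \sum_w k v w * f w - mean f) <= e ^+ 2 * sqnorm f].
Proof.
have [q q1 exp] := expanders; have q0 := ltnW q1; move=> e0.
have qR : 0 < q%:R :> R by rewrite ltr0n.
have [L L0 HL] := exp (e / q%:R) (divr_gt0 e0 qR).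
exists #|L| => V V0.
have /andP[Vge Vlt] := trunc_log_bounds q1 V0.
have [X cX [s [s_inj sm]]] := HL (trunc_log q #|V|).+1.
have [i i_inj] : exists i : V -> X, injective i.
  by apply: card_le_inj; rewrite cX ltnW.
exists (compression i s); split=> [v|w|f].
- exact: compression_sparse_row.
- exact: compression_sparse_col.
have X0 : (0 < #|X|)%N by rewrite cX expn_gt0 q0.
apply: le_trans (compression_approx i_inj X0 (conj s_inj sm) f) _.
rewrite ler_wpM2r ?sqnorm_ge0// lerXn2r ?nnegrE ?mulr_ge0 ?invr_ge0 ?(ltW e0)//.
rewrite mulrCA ler_piMr ?(ltW e0)// ler_pdivrMr// mul1r ler_pdivrMr ?ltr0n//.
by rewrite -natrM ler_nat cX expnS leq_mul2l Vge orbT.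
Qed.

End Expanders.

(** * The Schur test *)

Section Schur.
Variable R : realType.

Definition apply_kernel (V : finType) (k : V -> V -> R) (f : V -> R) (v : V) : R :=
  \sum_w k v w * f w.

Definition kernel_bounded (c : R) (V : finType) (k : V -> V -> R) : Prop :=
  forall f : V -> R, sqnorm (apply_kernel k f) <= c ^+ 2 * sqnorm f.

Lemma apply_kernelD (V : finType) (k l : V -> V -> R) f v :
  apply_kernel (fun v w => k v w + l v w) f v = apply_kernel k f v + apply_kernel l f v.
Proof. by rewrite /apply_kernel -big_split; apply: eq_bigr => w _ /=; rewrite mulrDl. Qed.

Lemma kernel_boundedD (V : finType) (k l : V -> V -> R) (a b : R) :
  0 < a -> 0 < b -> kernel_bounded a k -> kernel_bounded b l ->
  kernel_bounded (a + b) (fun v w => k v w + l v w).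
Proof.
move=> a0 b0 ka lb f; under eq_sqnorm do rewrite apply_kernelD.
exact: sqnormD (ka f) (lb f).
Qed.

Lemma kernel_boundedN (V : finType) (k : V -> V -> R) (a : R) :
  kernel_bounded a k -> kernel_bounded a (fun v w => - k v w).
Proof.
move=> ka f; apply: le_trans (ka f); rewrite le_eqVlt; apply/orP; left; apply/eqP.
apply: eq_bigr => v _; rewrite /apply_kernel -[RHS]sqrrN -sumrN; congr (_ ^+ 2).
by apply: eq_bigr => w _; rewrite mulNr.
Qed.

(** Cauchy-Schwarz with weights [`|a w|]: the sum of the `|a w| (f w -+ t) ^ 2,
    with the sign of [a w], is nonnegative for every [t].  The choice
    t = (sum of a f) / c, rather than the minimizer, needs no division by the
    sum of the weights, which may vanish. *)
Lemma sqr_weighted_sum_le (V : finType) (c : R) (a f : V -> R) : 0 < c ->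
  \sum_w `|a w| <= c ->
  (\sum_w a w * f w) ^+ 2 <= c * \sum_w `|a w| * f w ^+ 2.
Proof.
move=> c0 ac; set S := \sum_w a w * f w; set Q := \sum_w `|a w| * f w ^+ 2.
set A := \sum_w `|a w| in ac *.
pose t := S / c; have tc : t * c = S by rewrite /t divfK// gt_eqF.
have : 0 <= Q - 2 * t * S + t ^+ 2 * A.
  rewrite /Q /S /A !mulr_sumr -sumrB -big_split /=; apply: sumr_ge0 => w _.
  case: (ger0P (a w)) => aw.
    have -> : a w * f w ^+ 2 - 2 * t * (a w * f w) + t ^+ 2 * a w =
      a w * (f w - t) ^+ 2 by ring.
    by rewrite mulr_ge0 ?sqr_ge0.
  have -> : - a w * f w ^+ 2 - 2 * t * (a w * f w) + t ^+ 2 * - a w =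
    - a w * (f w + t) ^+ 2 by ring.
  by rewrite mulr_ge0 ?sqr_ge0// oppr_ge0 ltW.
have : t ^+ 2 * A <= t ^+ 2 * c by rewrite ler_wpM2l ?sqr_ge0.
rewrite -tc => h1 h2.
have {h1 h2} h : t ^+ 2 * c <= Q by nra.
have -> : (t * c) ^+ 2 = c * (t ^+ 2 * c) by ring.
by rewrite ler_pM2l.
Qed.

Lemma schur (V : finType) (k : V -> V -> R) (c : R) : 0 < c ->
  (forall v, \sum_w `|k v w| <= c) -> (forall w, \sum_v `|k v w| <= c) ->
  kernel_bounded c k.
Proof.
move=> c0 rows cols f.
apply: (@le_trans _ _ (\sum_v c * \sum_w `|k v w| * f w ^+ 2)).
  by apply: ler_sum => v _; exact: sqr_weighted_sum_le.
rewrite -mulr_sumr exchange_big expr2 -mulrA ler_pM2l// mulr_sumr.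
apply: ler_sum => w _; rewrite -mulr_suml ler_wpM2r ?sqr_ge0//.
Qed.

End Schur.

Lemma finset_card_eq (V : finType) (A : {set V}) : ([set` A] #= `I_#|A|)%card.
Proof.
have -> : [set` A] = [set` [fset x in A]%fset].
  by apply/seteqP; split=> x /=; rewrite in_fset.
by apply/card_eq_fsetP; rewrite card_finset.
Qed.

(** * Regular graphs that are almost complete *)

Section RegularGraph.
Variables (R : realType) (V : finType) (G : graph V) (n : nat).
Hypotheses (n_gt0 : (0 < n)%N) (Gn : regular n G).

Definition adj_kernel (v w : V) : R := (G v w)%:R / n%:R.

Definition laplacian_kernel (v w : V) : R := (v == w)%:R - adj_kernel v w.

Lemma degreeE (v : V) : degree G v = #|[set w | G v w]%SET|.
Proof.
rewrite /degree; apply: card_fset_set; rewrite -/(nbrs G v).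
have -> : nbrs G v = [set` [set w | G v w]%SET].
  by apply/seteqP; split=> w /=; rewrite inE.
exact: finset_card_eq.
Qed.

Let sum_adj v : \sum_w (G v w)%:R = n%:R :> R.
Proof.
rewrite -(Gn v) degreeE -sum1_card natr_sum [RHS]big_mkcond /=.
by apply: eq_bigr => w _; rewrite inE; case: (G v w).
Qed.

Lemma laplacian_kernel_bounded : kernel_bounded 2 laplacian_kernel.
Proof.
have rows v : \sum_w `|laplacian_kernel v w| <= 2.
  apply: (@le_trans _ _ (\sum_w ((v == w)%:R + (G v w)%:R / n%:R))).
    by apply: ler_sum => w _; rewrite (le_trans (ler_normB _ _))// !ger0_norm ?divr_ge0.
  rewrite big_split /= -mulr_suml sum_adj divff ?pnatr_eq0 -?lt0n//.
  rewrite (bigD1 v)//= eqxx big1 ?addr0// => w wv.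
  by rewrite eq_sym (negPf wv).
apply: schur => // w; apply: le_trans (rows w); apply: ler_sum => v _.
by rewrite /laplacian_kernel /adj_kernel eq_sym adj_sym.
Qed.

(** A row has [n] entries 1/n - 1/m and [m - n] entries -1/m, with absolute sum
    2 (1 - n/m) <= 2 (m/n - 1). *)
Lemma adj_sub_mean_bounded (d : R) : 0 < d -> (n <= #|V|)%N ->
  2 * (#|V|%:R / n%:R - 1) <= d ->
  kernel_bounded d (fun v w => adj_kernel v w - #|V|%:R^-1).
Proof.
move=> d0 nV nd; set m := #|V|%:R : R in nd *.
have m0 : 0 < m by rewrite ltr0n (leq_trans n_gt0).
have n0 : 0 < n%:R :> R by rewrite ltr0n.
have mn : m^-1 <= n%:R^-1 by rewrite lef_pV2 ?posrE// ler_nat.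
have rows v : \sum_w `|adj_kernel v w - m^-1| <= d.
  apply: le_trans nd.
  under eq_bigr => w _.
    rewrite (_ : `|_| = (G v w)%:R * (n%:R^-1 - 2 * m^-1) + m^-1); last first.
      rewrite /adj_kernel; case: (G v w) => /=.
        by rewrite mul1r ger0_norm ?subr_ge0//; ring.
      by rewrite mul0r sub0r normrN ger0_norm ?invr_ge0 ?ltW//; ring.
    over.
  rewrite big_split /= -mulr_suml sum_adj sumr_const -[m^-1 *+ _]mulr_natl -/m.
  have -> : n%:R * (n%:R^-1 - 2 * m^-1) + m * m^-1 = 2 * (1 - n%:R / m).
    by field; rewrite !gt_eqF.
  rewrite ler_pM2l// -subr_ge0.
  have -> : m / n%:R - 1 - (1 - n%:R / m) = (m - n%:R) ^+ 2 / (m * n%:R).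
    by field; rewrite !gt_eqF.
  by rewrite divr_ge0 ?sqr_ge0// mulr_ge0 ?ltW.
apply: schur => // w; apply: le_trans (rows w); apply: ler_sum => v _.
by rewrite /adj_kernel adj_sym.
Qed.

End RegularGraph.

(** * Block diagonal operators on l2 of a disjoint union *)

Lemma fsbig_finType (A : Type) (idx : A) (op : Monoid.com_law idx) (V : finType)
    (P : pred V) (F : V -> A) :
  \big[op/idx]_(v \in [set v | P v]) F v = \big[op/idx]_(v | P v) F v.
Proof.
symmetry; apply: bigfs; first exact: index_enum_uniq.
by move=> v _; rewrite mem_index_enum.
Qed.

Section BlockOperators.
Import ComplexField.Normc.
Variables (R : realType) (W : nat -> finType).

Let T : choiceType := {i : nat & W i}.
Local Notation block_point := (Tagged (fun i => W i)).
Implicit Types (k : forall i, W i -> W i -> R) (f : T -> R[i]^o).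

Lemma esum_tag (h : T -> R) : (forall x, 0 <= h x) ->
  (\esum_(x in [set: T]) (h x)%:E =
   \esum_(i in [set: nat]) (\sum_(v : W i) h (block_point v))%:E)%E.
Proof.
move=> h0; pose J (i : nat) : set T := block_point @` [set: W i].
have -> : [set: T] = \bigcup_(i in [set: nat]) J i.
  by apply/seteqP; split=> // -[i v] _; exists i => //; exists v.
rewrite esum_bigcupT; last by move=> x; rewrite lee_fin.
  apply: eq_esum => i _; rewrite esum_image; last first.
    by move=> v w _ _ /eqP; rewrite eq_Tagged => /eqP.
  rewrite esum_fset; [|exact: finite_finset|by move=> v _; rewrite lee_fin].
  have -> : [set: W i] = [set v | xpredT v] by apply/seteqP.
  by rewrite fsbig_finType sumEFin.
by move=> i j _ _ [x [[v _ <-] [w _ /(congr1 tag)]]].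
Qed.

Definition block_fun k f : T -> R[i]^o := fun x =>
  \sum_(w : W (tag x)) (k (tag x) (tagged x) w)%:C%C * f (block_point w).

Lemma block_fun_linear k : linear (block_fun k).
Proof.
move=> a f g; apply/funext => x; rewrite /block_fun !fctE scaler_sumr -big_split.
by apply: eq_bigr => w _ /=; rewrite mulrDr; congr (_ + _); exact: mulrCA.
Qed.

(** A uniform bound on real blocks bounds the whole operator on complex
    functions: the blocks act separately on real and imaginary parts, and
    squared norms add up over the blocks. *)
Lemma block_fun_esum_le k (c : R) f : (forall i, kernel_bounded c (k i)) ->
  (\esum_(x in [set: T]) (normc (block_fun k f x) ^+ 2)%:E <=
   (c ^+ 2)%:E * \esum_(x in [set: T]) (normc (f x) ^+ 2)%:E)%E.
Proof.
move=> kc; rewrite !esum_tag; try by move=> x; exact: sqr_ge0.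
apply: le_trans (esum_scale_le _ _).
- apply: le_esum => i _; rewrite -EFinM lee_fin.
  pose Re (v : W i) := complex.Re (f (block_point v)).
  pose Im (v : W i) := complex.Im (f (block_point v)).
  have -> : \sum_(v : W i) normc (block_fun k f (block_point v)) ^+ 2 =
            sqnorm (apply_kernel (k i) Re) + sqnorm (apply_kernel (k i) Im).
    rewrite /sqnorm -big_split; apply: eq_bigr => v _ /=.
    rewrite normc_sqr /block_fun /=; congr (_ ^+ 2 + _ ^+ 2).
      rewrite /apply_kernel /Re; elim/big_rec2: _ => //= w y1 y2 _ <-.
      by case: (f _) y2 => [? ?] [? ?] /=; rewrite mul0r subr0.
    rewrite /apply_kernel /Im; elim/big_rec2: _ => //= w y1 y2 _ <-.
    by case: (f _) y2 => [? ?] [? ?] /=; rewrite mul0r addr0.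
  under [in leRHS]eq_bigr do rewrite normc_sqr.
  by rewrite big_split mulrDr lerD//; exact: kc.
- exact: sqr_ge0.
- by move=> i; apply: sumr_ge0 => v _; exact: sqr_ge0.
Qed.

Lemma l2norm_block_le k (c : R) (f g : l2 R T) : 0 <= c ->
  (forall i, kernel_bounded c (k i)) -> (forall x, g x = block_fun k f x) ->
  l2norm g <= c * l2norm f.
Proof.
move=> c0 kc gE.
have : (\esum_(x in [set: T]) (normc (g x) ^+ 2)%:E <=
   (c ^+ 2)%:E * \esum_(x in [set: T]) (normc (f x) ^+ 2)%:E)%E.
  by under eq_esum do rewrite gE; exact: block_fun_esum_le.
have sge0 (h : l2 R T) : (0 <= \esum_(x in [set: T]) (normc (h x) ^+ 2)%:E)%E.
  by apply: esum_ge0 => x _; rewrite lee_fin sqr_ge0.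
rewrite /l2norm.
move: (l2_finite f) (l2_finite g) (sge0 f) (sge0 g).
case: (\esum_(x in _) (normc (f x) ^+ 2)%:E)%E => // a _.
case: (\esum_(x in _) (normc (g x) ^+ 2)%:E)%E => // b _ a0 b0.
rewrite -EFinM lee_fin /= => ab.
by rewrite -[X in X * _](ger0_norm c0) -sqrtr_sqr -sqrtrM ?sqr_ge0// ler_wsqrtr.
Qed.

Lemma opnorm_block_le k (c : R) (A : l2 R T -> l2 R T) : 0 <= c ->
  (forall i, kernel_bounded c (k i)) -> (forall (f : l2 R T) x, A f x = block_fun k f x) ->
  (opnorm A <= c%:E)%E.
Proof.
move=> c0 kc AE; apply: ge_ereal_sup => _ [f /= f1 <-]; rewrite lee_fin.
by apply: le_trans (l2norm_block_le c0 kc (AE f)) _; rewrite ler_piMr.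
Qed.

Lemma block_op_exists k (c : R) : (forall i, kernel_bounded c (k i)) ->
  exists A : {linear l2 R T -> l2 R T}, forall (f : l2 R T) x, A f x = block_fun k f x.
Proof.
move=> kc.
have sq (f : l2 R T) : block_fun k f \in @square_summable R T.
  rewrite square_summableE; apply: le_lt_trans (block_fun_esum_le f kc) _.
  by rewrite lte_mul_pinfty ?l2_finite// lee_fin sqr_ge0.
pose A (f : l2 R T) := L2 (sq f).
have A_linear : linear A by move=> a f g; apply: val_inj; exact: block_fun_linear.
pose AL := GRing.isLinear.Build R[i] (l2 R T) (l2 R T) _ A A_linear.
pose A' : {linear l2 R T -> l2 R T} := HB.pack A AL.
by exists A'.
Qed.

Lemma matrix_entry_block k (A : l2 R T -> l2 R T) (x y : T) :
  (forall (f : l2 R T) z, A f z = block_fun k f z) -> matrix_entry A x y != 0 ->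
  exists2 w, y = block_point w & k (tag x) (tagged x) w != 0.
Proof.
move=> AE; rewrite /matrix_entry AE; apply: contraNP => /forall2NP nk.
apply/eqP/big1 => w _ /=; case: eqP => [e|_]; last by rewrite mulr0.
by case: (nk w) => [/(_ (esym e))//|/negP]; rewrite negbK => /eqP ->; rewrite mul0r.
Qed.

Lemma sparse_block k (c : R) (d : nat) (A : {linear l2 R T -> l2 R T}) : 0 <= c ->
  (forall i, kernel_bounded c (k i)) -> (forall (f : l2 R T) x, A f x = block_fun k f x) ->
  (forall i v, (#|[set w | k i v w != 0%R]%SET| <= d)%N) ->
  (forall i w, (#|[set v | k i v w != 0%R]%SET| <= d)%N) ->
  sparse_op d A.
Proof.
move=> c0 kc AE rows cols.
have card_le i (B : {set W i}) (D : set T) : (#|B| <= d)%N ->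
    D `<=` block_point @` [set` B] -> (D #<= `I_d)%card.
  move=> Bd /subset_card_le DB; apply: card_le_trans DB _.
  apply: card_le_trans (card_image_le _ _) _.
  by rewrite (card_le_eql (finset_card_eq B)) card_le_II.
split.
- by apply: le_lt_trans (opnorm_block_le c0 kc AE) _; rewrite ltry.
- move=> x; apply: card_le (rows (tag x) (tagged x)) _ => y /= /(matrix_entry_block AE)[w -> kw].
  by exists w; rewrite //= inE.
- move=> [i w]; apply: card_le (cols i w) _ => -[j v] /= /(matrix_entry_block AE)[u e].
  have ij : i = j := congr1 tag e; case: j / ij v u e => v u /eqP.
  by rewrite eq_Tagged /= => /eqP <- kv; exists v; rewrite //= inE.
Qed.

End BlockOperators.

(** * The Laplacian of the disjoint union *)

Section Laplacian.
Variables (R : realType) (W : nat -> finType) (G : forall i, graph (W i)).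
Hypothesis regG : forall i, regular i.+1 (G i).
Local Notation block_point := (Tagged (fun i => W i)).

Lemma nbrs_dunion i (v : W i) :
  nbrs (dunion G) (block_point v) = block_point @` nbrs (G i) v.
Proof.
apply/seteqP; split=> [[j w]|_ [w vw <-]]; rewrite /nbrs /= /dunion_adj /=.
  case: eqP => //= ij; case: j / ij w => w.
  by rewrite tagged_asE => vw; exists w.
by rewrite eqxx tagged_asE.
Qed.

Lemma degree_dunion i (v : W i) : degree (dunion G) (block_point v) = i.+1.
Proof.
rewrite -(regG v) /degree nbrs_dunion.
apply/fcard_eq; [exact/finite_image/nbrs_fin|exact: nbrs_fin|].
apply: inj_card_eq => a b _ _ /eqP.
by rewrite eq_Tagged => /eqP.
Qed.

Lemma laplacian_block (f : l2 R {i : nat & W i}) x :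
  laplacian (dunion G) f x =
  block_fun (fun i => laplacian_kernel R (G i) i.+1) f x.
Proof.
case: x => i v; rewrite /= /laplacian_fun /block_fun /= nbrs_dunion.
have point_inj : set_inj (nbrs (G i) v) block_point.
  by move=> a b _ _ /eqP; rewrite eq_Tagged => /eqP.
rewrite fsbig_image// /nbrs fsbig_finType.
under [RHS]eq_bigr do rewrite /laplacian_kernel rmorphB mulrBl.
rewrite sumrB; congr (_ - _).
  rewrite (bigD1 v)//= eqxx mul1r big1 ?addr0// => w wv.
  by rewrite eq_sym (negPf wv) mul0r.
rewrite big_mkcond; apply: eq_bigr => w _.
rewrite !degree_dunion -expr2 sqrtr_sqr ger0_norm// /adj_kernel.
by case: (G i v w); rewrite ?mul1r// !mul0r.
Qed.

End Laplacian.

(* Sequences are indexed by n >= 1; the values at 0 are junk, and the disjoint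
   union runs over n = k.+1. *)
Theorem proposition7 (R : realType) (m : nat -> nat)
    (m_gt0 : forall n : nat, (0 < n)%N -> (0 < m n)%N)
    (m_ge : forall n : nat, (0 < n)%N -> (n <= m n)%N)
    (m_lim : (fun n : nat => (m n)%:R / n%:R : R) @ \oo --> (1 : R))
    (V : nat -> finType) (G : forall n : nat, graph (V n))
    (cardV : forall n : nat, (0 < n)%N -> #|V n| = m n)
    (regG : forall n : nat, (0 < n)%N -> regular n (G n)) :
  AULF R (dunion (fun k : nat => G k.+1)).
Proof.
pose W k : finType := V k.+1; pose H k : graph (W k) := G k.+1.
have regH k : regular k.+1 (H k) by exact: regG.
pose lap k := laplacian_kernel R (H k) k.+1.
have lapE f x : laplacian (dunion H) f x = block_fun lap f x := laplacian_block regH f x.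
have lap2 k : kernel_bounded 2 (lap k) by exact: laplacian_kernel_bounded.
split=> [|e e0].
  by apply: le_lt_trans (opnorm_block_le _ lap2 lapE) _; rewrite ?ltry.
have e4 : 0 < e / 4 by rewrite divr_gt0.
have [d sparse] := sparse_mean e4.
have W0 k : (0 < #|W k|)%N by rewrite cardV// m_gt0.
pose avg k := sval (cid (sparse (W k) (W0 k))).
have [avg_row avg_col avg_close] : [/\
    forall k v, (#|[set w | avg k v w != 0%R]%SET| <= d)%N,
    forall k w, (#|[set v | avg k v w != 0%R]%SET| <= d)%N &
    forall k, kernel_bounded (e / 4) (fun v w => avg k v w - #|W k|%:R^-1)].
  split=> k; have := svalP (cid (sparse (W k) (W0 k))) => -[rows cols close] //.
  move=> f; apply: le_trans (close f).
  rewrite le_eqVlt; apply/orP; left; apply/eqP/eq_sqnorm => v.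
  rewrite /apply_kernel /mean mulr_sumr -sumrB.
  by apply: eq_bigr => w _; rewrite mulrBl.
(* From the block [N] on, the graphs are almost complete. *)
have [N _ large] : \forall n \near \oo, `|1 - (m n)%:R / n%:R| < e / 8 :> R.
  by move/cvgrPdist_lt : m_lim; apply; rewrite divr_gt0.
(* The sparse operator: the Laplacian itself on the first [N] blocks, and the
   sparse approximation of 1 - J / m on the others. *)
pose s k v w := if (k < N)%N then lap k v w else (v == w)%:R - avg k v w.
pose D := (d + \max_(j < N) #|W j|).+1.
have diff_le k : kernel_bounded (e / 2) (fun v w => lap k v w - s k v w).
  rewrite /s; case: ltnP => kN.
    move=> f; rewrite [sqnorm _]big1 => [|v _].
      by rewrite mulr_ge0 ?sqr_ge0 ?sqnorm_ge0.
    by rewrite /apply_kernel big1 ?expr0n// => w _; rewrite subrr mul0r.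
  have -> : (fun v w => lap k v w - ((v == w)%:R - avg k v w)) =
    (fun v w => (avg k v w - #|W k|%:R^-1) +
      - (adj_kernel R (H k) k.+1 v w - #|W k|%:R^-1)).
    by apply/funext => v; apply/funext => w; rewrite /lap /laplacian_kernel; ring.
  have -> : e / 2 = e / 4 + e / 4 by field.
  apply: kernel_boundedD => //; apply: kernel_boundedN.
  apply: adj_sub_mean_bounded => //; first by rewrite cardV// m_ge.
  rewrite cardV//; have := large k.+1 (leqW kN); rewrite distrC => /ltW.
  have -> : e / 4 = 2 * (e / 8) by field.
  by move=> /(le_trans (ler_norm _)); rewrite ler_pM2l.
(* Being within [e / 2] of the Laplacian, whose norm is at most 2, it is bounded. *)
have s_bounded k : kernel_bounded (2 + e / 2) (s k).
  have -> : s k = fun v w => lap k v w + - (lap k v w - s k v w).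
    by apply/funext => v; apply/funext => w; ring.
  by apply: kernel_boundedD; rewrite ?divr_gt0//; apply: kernel_boundedN.
have [S SE] := block_op_exists s_bounded.
exists S; last first.
  apply: (@le_lt_trans _ _ (e / 2)%:E); last by rewrite lte_fin; lra.
  apply: (opnorm_block_le _ diff_le) => [|f x]; first by rewrite divr_ge0// ltW.
  transitivity (laplacian (dunion H) f x - S f x) => //.
  rewrite lapE SE /block_fun -sumrB; apply: eq_bigr => w _.
  by rewrite [in RHS]rmorphB mulrBl.
exists D => //; apply: (sparse_block _ s_bounded SE).
- by rewrite addr_ge0// divr_ge0// ltW.
- move=> k v; rewrite /s; case: ltnP => kN.
    rewrite (leq_trans (max_card _))// leqW// (leq_trans _ (leq_addl _ _))//.
    exact: (leq_bigmax (Ordinal kN)).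
  apply: (@leq_trans #|v |: [set w | avg k v w != 0%R]%SET|).
    apply: subset_leq_card; apply/fintype.subsetP => w; rewrite !inE.
    by apply: contraNT; rewrite negb_or negbK eq_sym => /andP[/negPf -> /eqP ->]; rewrite subrr.
  rewrite cardsU1 (leq_trans (leq_add (leq_b1 _) (avg_row k v)))//.
  by rewrite add1n ltnS leq_addr.
- move=> k w; rewrite /s; case: ltnP => kN.
    rewrite (leq_trans (max_card _))// leqW// (leq_trans _ (leq_addl _ _))//.
    exact: (leq_bigmax (Ordinal kN)).
  apply: (@leq_trans #|w |: [set v | avg k v w != 0%R]%SET|).
    apply: subset_leq_card; apply/fintype.subsetP => v; rewrite !inE.
    by apply: contraNT; rewrite negb_or negbK => /andP[/negPf -> /eqP ->]; rewrite subrr.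
  rewrite cardsU1 (leq_trans (leq_add (leq_b1 _) (avg_col k w)))//.
  by rewrite add1n ltnS leq_addr.
Qed.
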